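(* Let $n \ge 1$ and $C \subseteq \mathbb{F}_3^n$. Then $C$ is a greedy capset if and only if there is an affine hyperplane $H_0 \subseteq \mathbb{F}_3^n$ such that $C \cap H_0 = \emptyset$ and, denoting by $H_1, H_2$ the two hyperplanes of $\mathbb{F}_3^n$ parallel to (and distinct from) $H_0$, for each $i = 1,2$ the set $C \cap H_i$ is a greedy capset of the $(n-1)$-dimensional affine space $H_i$ (so that, recursively, $C\cap H_i$ misses a hyperplane of $H_i$ and meets the two parallel hyperplanes of $H_i$ in greedy capsets, and so on). In particular, every greedy capset $C \subseteq \mathbb{F}_3^n$ satisfies $\#C = 2^n$.
   Context: A line in an affine space $A$ over $\mathbb{F}_3$ (e.g. $A=\mathbb{F}_3^n$ or an affine subspace of it) is a one-dimensional affine subspace; it has three points. A subset of $A$ is a capset if it contains no line. A hyperplane of $\mathbb{F}_3^n$ is a set $\{x : \sum_i a_i x_i + b = 0\}$ with $a_i, b \in \mathbb{F}_3$, not all $a_i$ zero; the hyperplanes parallel to it are $\{x : \sum_i a_i x_i + c = 0\}$ with $c \ne b$ (hyperplanes of an affine subspace are defined analogously, as its affine subspaces of codimension one, and its parallel hyperplanes as the other translates). Greedy construction in an affine space $A$ of dimension $m \ge 0$ over $\mathbb{F}_3$: start with $S_0 = A$; if $S_{i-1}$ is a capset, stop; otherwise set $S_i = S_{i-1} \setminus \{P_i\}$, where $P_i$ is any point $P \in S_{i-1}$ for which the number of lines through $P$ that are contained in $S_{i-1}$ is positive and maximal among all points of $S_{i-1}$. The procedure terminates at a capset (the choices of $P_i$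 among tied points are arbitrary). A subset of $A$ is a greedy capset if it is the output of some such greedy construction. *)

(* Defs.v *)
From mathcomp Require Import all_boot all_order all_algebra.

Set Implicit Arguments.
Unset Strict Implicit.
Unset Printing Implicit Defensive.

Import GRing.Theory.
Local Open Scope ring_scope.

(* The direction of the subspace is the row space of U, so the dimension is *)
(* the rank of U.                                                           *)
Definition affine_subspace (n d : nat) (A : {set 'rV['F_3]_n}) : bool :=
  [exists p : 'rV['F_3]_n, exists U : 'M['F_3]_n,
    (\rank U == d) && (A == [set x | (x - p <= U)%MS])].

Definition is_line (n : nat) (L : {set 'rV['F_3]_n}) : bool :=
  affine_subspace 1 L.

Definition capset (n : nat) (S : {set 'rV['F_3]_n}) : bool :=
  [forall L : {set 'rV['F_3]_n}, is_line L ==> ~~ (L \subset S)].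

Definition hyperplane (n : nat) (a : 'rV['F_3]_n) (b : 'F_3) :
    {set 'rV['F_3]_n} :=
  [set x : 'rV['F_3]_n | \sum_(i < n) a 0 i * x 0 i + b == 0].

Definition hyperplane_of (n : nat) (A H : {set 'rV['F_3]_n}) : Prop :=
  H \subset A /\ exists d : nat, affine_subspace d.+1 A /\ affine_subspace d H.

Definition parallel_in (n : nat) (A H H' : {set 'rV['F_3]_n}) : Prop :=
  [/\ H' \subset A, H' != H &
      exists v : 'rV['F_3]_n, H' = [set v + x | x in H]].

Definition num_lines (n : nat) (S : {set 'rV['F_3]_n}) (P : 'rV['F_3]_n) : nat :=
  #|[set L : {set 'rV['F_3]_n} | [&& is_line L, P \in L & L \subset S]]|.

(* The ambient affine space A is an affine subspace of F_3^n; its lines are  *)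
(* the lines of F_3^n contained in it, so num_lines needs no reference to A. *)
Inductive greedy_stage (n : nat) (A : {set 'rV['F_3]_n}) :
    {set 'rV['F_3]_n} -> Prop :=
| greedy_start : greedy_stage A A
| greedy_remove (S : {set 'rV['F_3]_n}) (P : 'rV['F_3]_n) :
    greedy_stage A S -> ~~ capset S ->
    P \in S -> (0 < num_lines S P)%N ->
    (forall Q, Q \in S -> (num_lines S Q <= num_lines S P)%N) ->
    greedy_stage A (S :\ P).

Definition greedy_capset (n : nat) (A C : {set 'rV['F_3]_n}) : Prop :=
  greedy_stage A C /\ capset C.

(* Iterated splitting of C, for A of dimension d, down to single points.     *)
Fixpoint recursively_split (n d : nat) (A C : {set 'rV['F_3]_n}) : Prop :=
  greedy_capset A C /\
  match d with
  | 0 => True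
  | d'.+1 => exists H0 : {set 'rV['F_3]_n},
      [/\ hyperplane_of A H0, C :&: H0 = set0 &
          forall H, parallel_in A H0 H -> recursively_split d' H (C :&: H)]
  end.

(* Main.v *)
(* Write x, y, -(x+y) for the points of a line. If R is the set of removed
   points, the number of lines through P in the complement of R equals a
   constant minus |R| plus the number of chords of R whose third point is P.
   Hence the greedy rule maximises the number of chords through P, so it never
   leaves the affine hull of R before R is itself an affine subspace; the
   removed set therefore lies in a hyperplane until it fills one, H_0. After
   that every remaining line lies in one of the two parallels H_1, H_2, and a
   greedy construction is an interleaving of greedy constructions in H_1 and
   H_2. Conversely two such constructions can be interleaved by always taking
   the next point through which more lines pass. *)

Require Import Defs.
From mathcomp Require Import all_boot all_order all_algebra zify ring.

Set Implicit Arguments.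
Unset Strict Implicit.
Unset Printing Implicit Defensive.

Import GRing.Theory.
Local Open Scope ring_scope.

(* The third point of the line through x and y, and x itself when x = y. *)
Definition third (n : nat) (x y : 'rV['F_3]_n) : 'rV['F_3]_n := - (x + y).

(** Over ['F_3] the nonempty sets of this kind are exactly the affine subspaces. The empty set
    qualifies too, which suits the removed set at the start of a greedy run. *)
Definition third_closed (n : nat) (A : {set 'rV['F_3]_n}) : Prop :=
  {in A &, forall x y, third x y \in A}.

Definition dot (n : nat) (a x : 'rV['F_3]_n) : 'F_3 := \sum_(i < n) a 0 i * x 0 i.

Lemma F3P (k : 'F_3) : [\/ k = 0, k = 1 | k = -1].
Proof.
case: k => [[|[|[|k]]] lt_k] //.
- by apply: Or31; apply: val_inj.
- by apply: Or32; apply: val_inj.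
- by apply: Or33; apply: val_inj.
Qed.

(** The three elements of ['F_3] sum to zero. *)
Lemma F3_distinct (x y z : 'F_3) : x != y -> x != z -> y != z -> z = - (x + y).
Proof.
by case: (F3P x) => ->; case: (F3P y) => ->; case: (F3P z) => -> //= *; apply: val_inj.
Qed.

(** * Lines, third points and chords *)

Section Third.
Variable n : nat.
Implicit Types (x y p v : 'rV['F_3]_n) (A L R S : {set 'rV['F_3]_n}).

Lemma addvv x : x + x = - x.
Proof. by apply/rowP => i; rewrite !mxE; case: (F3P (x 0 i)) => ->; apply: val_inj. Qed.

Lemma thirdC x y : third x y = third y x.
Proof. by rewrite /third addrC. Qed.

Lemma thirdxx x : third x x = x.
Proof. by rewrite /third addvv opprK. Qed.

Lemma thirdK x y : third (third x y) y = x.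
Proof. by rewrite /third opprD opprK addrK. Qed.

Lemma third_eqr x y : (third x y == y) = (x == y).
Proof.
apply/eqP/eqP => [e | ->]; last exact: thirdxx.
by rewrite -(thirdK x y) e thirdxx.
Qed.

Lemma third_eql x y : (third x y == x) = (x == y).
Proof. by rewrite thirdC third_eqr eq_sym. Qed.

Lemma third_addv p v : third p (p + v) = p - v.
Proof. by rewrite /third addrA addvv opprD opprK. Qed.

(** A direction of rank 1 is spanned by one nonzero row, and its multiples by 0, 1 and -1 give the
    three points. *)
Lemma lineP L :
  reflect (exists x y, x != y /\ L = [set x; y; third x y]) (is_line L).
Proof.
apply: (iffP existsP) => [[p /existsP[U /andP[/eqP rkU /eqP ->]]] | [x [y [neq ->]]]].
  have Unz : U != 0 by rewrite -mxrank_eq0 rkU.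
  have Unv : nz_row U != 0 by rewrite nz_row_eq0.
  have eqU : (nz_row U == U)%MS.
    by rewrite -(geq_leqif (mxrank_leqif_eq (nz_row_sub U))) rkU rank_rV Unv.
  exists p, (p + nz_row U); split.
    by rewrite -subr_eq0 opprD addNKr oppr_eq0.
  rewrite third_addv; apply/setP => x; rewrite !inE -(eqmxP eqU).
  apply/sub_rVP/idP => [[k e]|].
    rewrite -(subrK p x) e; case: (F3P k) => ->.
    - by rewrite scale0r add0r eqxx.
    - by rewrite scale1r addrC eqxx orbT.
    - by rewrite scaleN1r addrC eqxx orbT.
  case/orP => [/orP[]|] /eqP ->.
  - by exists 0; rewrite subrr scale0r.
  - by exists 1; rewrite addrAC subrr add0r scale1r.
  - by exists (-1); rewrite addrAC subrr add0r scaleN1r.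
exists x; apply/existsP; exists (<<y - x>>%MS).
have nz : y - x != 0 by rewrite subr_eq0 eq_sym.
rewrite genmxE rank_rV nz /=; apply/eqP/setP => z.
have ez : third x y = x - (y - x) by rewrite -third_addv addrC subrK.
rewrite !inE genmxE ez; apply/idP/sub_rVP => [|[k e]].
  case/orP => [/orP[]|] /eqP ->.
  - by exists 0; rewrite subrr scale0r.
  - by exists 1; rewrite scale1r.
  - by exists (-1); rewrite addrAC subrr add0r scaleN1r.
rewrite -(subrK x z) e; case: (F3P k) => ->.
- by rewrite scale0r add0r eqxx.
- by rewrite scale1r subrK eqxx orbT.
- by rewrite scaleN1r [- _ + x]addrC eqxx orbT.
Qed.

Lemma is_line_third x y : x != y -> is_line [set x; y; third x y].
Proof. by move=> neq; apply/lineP; exists x, y. Qed.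

Lemma card_line L : is_line L -> #|L| = 3.
Proof.
case/lineP => x [y [neq ->]]; rewrite -setUA !cardsU1 cards1 !inE.
by rewrite (negPf neq) ![_ == third _ _]eq_sym third_eql third_eqr (negPf neq).
Qed.

Lemma line_closed L : is_line L -> third_closed L.
Proof.
case/lineP => x [y [_ ->]] u v; set t := third x y.
have ex : third t x = y by rewrite /t (thirdC x) thirdK.
have ey : third t y = x by rewrite /t thirdK.
rewrite !inE => /orP[/orP[]|] /eqP -> /orP[/orP[]|] /eqP ->;
  by rewrite ?thirdxx ?(thirdC _ t) ?(thirdC y x) ?ex ?ey ?eqxx ?orbT.
Qed.

Lemma line_eq L x y : is_line L -> x \in L -> y \in L -> x != y ->
  L = [set x; y; third x y].
Proof.
move=> lL xL yL neq; apply/esym/eqP; rewrite eqEcard (card_line lL).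
rewrite (card_line (is_line_third neq)) leqnn andbT.
by rewrite !subUset !sub1set xL yL line_closed.
Qed.

(** Double counting of incidences: each line through [x] inside [S] has two points besides [x], and
    each such point lies on just one of these lines. The extra 1 is [y = x], whose third point with
    [x] is [x] itself. *)
Lemma num_lines_double S x : x \in S ->
  #|[set y in S | third y x \in S]| = (num_lines S x).*2.+1.
Proof.
move=> xS; set T := [set y in S | _].
have xT : x \in T by rewrite /T inE thirdxx xS.
rewrite (cardsD1 x) xT add1n; congr _.+1.
rewrite /num_lines; set Ls := [set L | _].
have LsE L : L \in Ls -> (\sum_(y in T :\ x) (y \in L) = 2)%N.
  rewrite inE => /and3P[lL xL LS].
  have -> : (\sum_(y in T :\ x) (y \in L) = #|L :\ x|)%N.
    rewrite -sum1_card big_mkcond /= [RHS]big_mkcond /=; apply: eq_bigr => y _.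
    rewrite !inE; have [-> | _] := eqVneq y x => //=.
    have [yL | _] := boolP (y \in L); last by case: ifP.
    by rewrite (subsetP LS) // (subsetP LS) // line_closed.
  by have := card_line lL; rewrite (cardsD1 x) xL => -[].
have TE y : y \in T :\ x -> (\sum_(L in Ls) (y \in L) = 1)%N.
  rewrite !inE => /and3P[neq yS tS].
  have L0 : [set x; y; third x y] \in Ls.
    rewrite inE is_line_third 1?eq_sym // !subUset !sub1set !inE eqxx xS yS.
    by rewrite thirdC.
  rewrite (bigD1 _ L0) /= big1; first by rewrite !inE eqxx orbT.
  move=> L /andP[LLs /eqP neqL].
  have : L \in Ls by []; rewrite inE => /and3P[lL xL _].
  apply/eqP; rewrite eqb0; apply/negP => yL; apply: neqL.
  by apply: line_eq => //; rewrite eq_sym.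
rewrite -sum1_card -(eq_bigr _ TE) exchange_big /= (eq_bigr _ LsE).
by rewrite sum_nat_const muln2.
Qed.

Lemma num_lines_gt0P S x : x \in S ->
  reflect (exists y, [/\ y \in S, y != x & third y x \in S]) (0 < num_lines S x)%N.
Proof.
move=> xS; apply: (iffP card_gt0P) => [[L] | [y [yS neq tS]]].
  rewrite inE => /and3P[lL xL LS].
  have /card_gt0P[y] : (0 < #|L :\ x|)%N.
    by have := card_line lL; rewrite (cardsD1 x) xL add1n => -[->].
  rewrite !inE => /andP[neq yL]; exists y; split => //; rewrite (subsetP LS) //.
  exact: line_closed.
exists [set x; y; third x y]; rewrite inE is_line_third 1?eq_sym //.
by rewrite !subUset !sub1set !inE eqxx xS yS thirdC.
Qed.

Lemma num_lines_noncapset S x : (0 < num_lines S x)%N -> ~~ capset S.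
Proof.
case/card_gt0P => L; rewrite inE => /and3P[lL _ LS].
by apply/forallPn; exists L; rewrite lL LS.
Qed.

Lemma capset_num_lines S x : capset S -> num_lines S x = 0%N.
Proof. by move=> cS; case: (posnP (num_lines S x)) => // /num_lines_noncapset; rewrite cS. Qed.

Lemma capsetP S :
  reflect (forall x, x \in S -> num_lines S x = 0%N) (capset S).
Proof.
apply: (iffP idP) => [cS x _ | h]; first exact: capset_num_lines.
apply/forallP => L; apply/implyP => lL; apply/negP => LS.
have /card_gt0P[x xL] : (0 < #|L|)%N by rewrite card_line.
suff : (0 < num_lines S x)%N by rewrite h // (subsetP LS).
by apply/card_gt0P; exists L; rewrite inE lL xL.
Qed.

(** For [x] outside [R] this is twice the number of chords of [R] with third point [x], since both
    ends are counted. *)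
Definition chords R x : nat :=
  #|[set y in R | third y x \in R]|.

Lemma chords_gt0P R x :
  reflect (exists2 y, y \in R & third y x \in R) (0 < chords R x)%N.
Proof.
by apply: (iffP card_gt0P) => -[y]; rewrite ?inE; [case/andP; exists y | move=> *; exists y; rewrite inE; apply/andP].
Qed.

(** The involution [y -> third y x] preserves [A]. Both [S] and its complement [R] split according
    to where the image falls, and the points crossing from [S] to [R] match those crossing back. *)
Lemma num_lines_chords A S x : third_closed A -> S \subset A -> x \in S ->
  ((num_lines S x).*2.+1 + #|A :\: S| = #|S| + chords (A :\: S) x)%N.
Proof.
move=> cA SA xS; rewrite -num_lines_double // /chords; set R := A :\: S.
have xA : x \in A by apply: (subsetP SA).
have tK : involutive (fun y => third y x) by move=> y; rewrite thirdK.
set f := fun y => third y x in tK.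
have fA y : (f y \in A) = (y \in A).
  apply/idP/idP => yA; last exact: cA.
  by rewrite -(tK y); apply: cA.
have dS : (#|S| = #|[set y in S | f y \in S]| + #|[set y in S | f y \in R]|)%N.
  rewrite -(cardsID (f @^-1: S) S); congr (_ + _)%N; apply: eq_card => y.
    by rewrite !inE.
  rewrite !inE fA; have [yS | ] := boolP (y \in S); last by rewrite andbF.
  by rewrite (subsetP SA) // andbT.
have dR : (#|R| = #|[set y in R | f y \in R]| + #|[set y in R | f y \in S]|)%N.
  rewrite -(cardsID (f @^-1: R) R); congr (_ + _)%N; apply: eq_card => y.
    by rewrite !inE.
  rewrite !inE fA; case: (y \in S) => //=; rewrite ?andbF //.
  by case: (y \in A); rewrite ?andbF ?andbT ?negbK.
have eSR : #|[set y in S | f y \in R]| = #|[set y in R | f y \in S]|.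
  rewrite -(card_imset _ (inv_inj tK)); apply: eq_card => y.
  apply/imsetP/idP => [[z] | ]; rewrite inE.
    by case/andP => zS zR ->; rewrite inE zR tK zS.
  by case/andP => yR fS; exists (f y); rewrite ?tK // inE fS tK.
by rewrite dS dR eSR -addnA; congr addn; rewrite addnC.
Qed.

Lemma num_lines_leE A S x y : third_closed A -> S \subset A -> x \in S -> y \in S ->
  (num_lines S x <= num_lines S y)%N = (chords (A :\: S) x <= chords (A :\: S) y)%N.
Proof.
move=> cA SA xS yS.
by have := num_lines_chords cA SA xS; have := num_lines_chords cA SA yS; lia.
Qed.

End Third.

(** * Linear functionals and hyperplanes *)

Section Dot.
Variable n : nat.
Implicit Types (a x y q : 'rV['F_3]_n) (A R S : {set 'rV['F_3]_n}) (b c : 'F_3).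

Lemma dot_mulmx a x : dot a x = (x *m a^T) 0 0.
Proof. by rewrite mxE; apply: eq_bigr => i _; rewrite !mxE mulrC. Qed.

Lemma dotD a x y : dot a (x + y) = dot a x + dot a y.
Proof. by rewrite !dot_mulmx mulmxDl mxE. Qed.

Lemma dotN a x : dot a (- x) = - dot a x.
Proof. by rewrite !dot_mulmx mulNmx mxE. Qed.

Lemma dotB a x y : dot a (x - y) = dot a x - dot a y.
Proof. by rewrite dotD dotN. Qed.

Lemma dotZBl k l a a' x : dot (k *: a - l *: a') x = k * dot a x - l * dot a' x.
Proof. rewrite /dot !mulr_sumr -sumrB; apply: eq_bigr => i _.
by rewrite !mxE mulrBl !mulrA. Qed.

Lemma dot_third a x y : dot a (third x y) = - (dot a x + dot a y).
Proof. by rewrite dotN dotD. Qed.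

Lemma dotC a x : dot a x = dot x a.
Proof. by apply: eq_bigr => i _; rewrite mulrC. Qed.

Lemma dot_delta a i : dot a (delta_mx 0 i) = a 0 i.
Proof. by rewrite dot_mulmx -rowE !mxE. Qed.

Lemma rV_neq0 a : a != 0 -> exists i, a 0 i != 0.
Proof.
move=> nz; apply/existsP; apply: contraR nz => /existsPn h.
by apply/eqP/rowP => i; rewrite mxE; apply/eqP; have := h i; rewrite negbK.
Qed.

Lemma in_hyperplane a b x : (x \in hyperplane a b) = (dot a x == - b).
Proof. by rewrite inE addr_eq0. Qed.

Lemma in_hyperplaneN a x : x \in hyperplane a (- dot a x).
Proof. by rewrite in_hyperplane opprK. Qed.

Lemma hyperplane_closed a b : third_closed (hyperplane a b).
Proof.
move=> x y; rewrite !in_hyperplane dot_third => /eqP-> /eqP->.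
by case: (F3P b) => ->.
Qed.

Lemma affine_subspace_closed d A : affine_subspace d A -> third_closed A.
Proof.
case/existsP => p /existsP[U /andP[_ /eqP->]] x y; rewrite !inE => xU yU.
have -> : third x y - p = - (x - p) - (y - p).
  apply/rowP => i; rewrite !mxE.
  by case: (F3P (x 0 i)) => ->; case: (F3P (y 0 i)) => ->;
    case: (F3P (p 0 i)) => ->; apply: val_inj.
by rewrite addmx_sub // eqmx_opp.
Qed.

(** Closure under third points makes [R] a translate of a linear subspace, so a functional vanishing
    on that subspace but not at [q - r] separates [q] from [R]. *)
Lemma closed_separation R q : third_closed R -> R != set0 -> q \notin R ->
  exists a, exists2 r, r \in R &
    {in R, forall x, dot a x = dot a r} /\ dot a q != dot a r.
Proof.
move=> cR /set0Pn[r rR] qR.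
pose U := (\sum_(x in R) <<x - r>>)%MS.
(* Taking third points twice turns closure of [R] into closure of its directions under addition. *)
have cD x y : r + x \in R -> r + y \in R -> r + (x + y) \in R.
  have -> : r + (x + y) = third (third (r + x) (r + y)) r.
    by rewrite /third opprD opprK addrACA addrAC addrK.
  by move=> xR yR; rewrite cR // cR.
have cZ (k : 'F_3) x : r + x \in R -> r + k *: x \in R.
  case: (F3P k) => ->; rewrite ?scale0r ?scale1r ?scaleN1r ?addr0 //.
  by move=> xR; rewrite -third_addv; apply: cR.
have subU x : (x <= U)%MS -> r + x \in R.
  case/sub_sumsmxP => u ->.
  apply: (big_ind (fun v => r + v \in R)) => [||y yR] //; first by rewrite addr0.
  have : (u y *m <<y - r>> <= y - r)%MS by rewrite -(genmxE (y - r)) submxMl.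
  by case/sub_rVP => k ->; apply: cZ; rewrite addrC subrK.
have qU : ~~ (q - r <= U)%MS.
  by apply: contra qR => /subU; rewrite addrC subrK.
have [j nzj] : exists j, ((q - r) *m cokermx U) 0 j != 0.
  by apply: rV_neq0; rewrite submxE in qU.
(* Every column of the cokernel kills [U]; column [j] is one that does not kill [q - r]. *)
exists (col j (cokermx U))^T.
have dE x : dot (col j (cokermx U))^T x = (x *m cokermx U) 0 j.
  by rewrite dot_mulmx trmxK colE mulmxA -colE mxE.
exists r => //; split=> [x xR|]; last by rewrite -subr_eq0 -dotB dE.
apply/eqP; rewrite -subr_eq0 -dotB dE.
have : (x - r <= U)%MS.
  by rewrite -(genmxE (x - r)) (sumsmx_sup x).
by rewrite submxE => /eqP ->; rewrite mxE.
Qed.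

End Dot.

(** If [u] and [v] differed, [u], [v] and [- (u + v)] would exhaust ['F_3] and one of them would be
    [b]. *)
Lemma F3_avoid (b u v : 'F_3) : u != b -> v != b -> - (u + v) != b -> u = v.
Proof.
by case: (F3P b) => ->; case: (F3P u) => ->; case: (F3P v) => -> //= *; apply: val_inj.
Qed.

Lemma F3_addr_neq (b k : 'F_3) : k != 0 -> b + k != b.
Proof. by rewrite -{2}[b]addr0 (inj_eq (addrI _)). Qed.

(** * Greedy choices and slices by parallel hyperplanes *)

Section Greedy.
Variable n : nat.
Implicit Types (a x y p q r v : 'rV['F_3]_n) (A B C D R S : {set 'rV['F_3]_n}).
Implicit Types (b c : 'F_3).

(** Says that the functional is not constant on [A], so that for an affine subspace [A] its level
    sets cut out genuine hyperplanes of [A]. *)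
Definition transverse a A : Prop :=
  exists x y, [/\ x \in A, y \in A & dot a x != dot a y].

Definition greedy_choice S p : Prop :=
  [/\ p \in S, (0 < num_lines S p)%N &
      forall q, q \in S -> (num_lines S q <= num_lines S p)%N].

Lemma transverse_neq a A p : transverse a A -> exists2 x, x \in A & dot a x != dot a p.
Proof.
case=> x [y [xA yA neq]]; have [e | ?] := eqVneq (dot a x) (dot a p); last by exists x.
by exists y; rewrite // -e eq_sym.
Qed.

(** If neither witness takes the value [- b], their third point takes the one value left. *)
Lemma transverse_meets a b A : third_closed A -> transverse a A ->
  exists2 x, x \in A & x \in hyperplane a b.
Proof.
move=> cA [x [y [xA yA neq]]].
have [ex | nx] := eqVneq (dot a x) (- b); first by exists x; rewrite ?in_hyperplane ?ex.
have [ey | ny] := eqVneq (dot a y) (- b); first by exists y; rewrite ?in_hyperplane ?ey.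
exists (third x y); first exact: cA.
by rewrite in_hyperplane dot_third -(F3_distinct neq nx ny).
Qed.

Lemma hyperplane_inj a b c x : x \in hyperplane a b -> x \in hyperplane a c -> b = c.
Proof. by rewrite !in_hyperplane => /eqP-> /eqP/oppr_inj. Qed.

Lemma avoid_hyperplane a b S x : S :&: hyperplane a b = set0 -> x \in S ->
  dot a x != - b.
Proof.
move=> S0 xS; rewrite -in_hyperplane; apply/negP => xb.
by have := in_set0 x; rewrite -S0 inE xS xb.
Qed.

Lemma hyperplane_cover a b S : S :&: hyperplane a b = set0 ->
  S = (S :&: hyperplane a (b + 1)) :|: (S :&: hyperplane a (b - 1)).
Proof.
move=> S0; apply/setP => x; rewrite in_setU !in_setI -andb_orr.
have [xS | //] := boolP (x \in S); apply/esym.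
have := avoid_hyperplane S0 xS; rewrite !in_hyperplane.
by case: (F3P b) => ->; case: (F3P (dot a x)) => ->.
Qed.

(** A line on which the functional varies takes all three values and so meets every hyperplane of
    the parallel class. *)
Lemma avoid_hyperplane_third a b S x y : S :&: hyperplane a b = set0 ->
  x \in S -> y \in S -> third x y \in S -> dot a x = dot a y.
Proof.
move=> S0 xS yS tS; apply: (F3_avoid (avoid_hyperplane S0 xS)).
  exact: avoid_hyperplane yS.
by rewrite -dot_third; apply: avoid_hyperplane tS.
Qed.

Lemma num_lines_slice a b c S x : S :&: hyperplane a b = set0 ->
  x \in S -> x \in hyperplane a c ->
  num_lines (S :&: hyperplane a c) x = num_lines S x.
Proof.
move=> S0 xS xc; apply: eq_card => L; rewrite !inE subsetI.
apply/and4P/and3P => [[? ? ? _] | [lL xL LS]]; split=> //.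
apply/subsetP => y yL; move: xc; rewrite !in_hyperplane.
by rewrite (avoid_hyperplane_third S0 _ (subsetP LS _ yL)) // (subsetP LS) // line_closed.
Qed.

(** A line joining [q] to a point of [A] off the hyperplane meets the hyperplane in [q] only, so no
    removal inside the hyperplane destroys it. *)
Lemma num_lines_transverse a b A R q : third_closed A -> transverse a A ->
  R \subset hyperplane a b -> q \in A -> q \in hyperplane a b -> q \notin R ->
  (0 < num_lines (A :\: R) q)%N.
Proof.
move=> cA tA Rb qA qb qR; have [y yA neq] := transverse_neq q tA.
have yb : y \notin hyperplane a b.
  by move: qb; rewrite !in_hyperplane => /eqP <-.
have tb : third y q \notin hyperplane a b.
  by apply: contra yb => tb; rewrite -(thirdK y q) hyperplane_closed.
apply/num_lines_gt0P; first by rewrite inE qR.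
exists y; rewrite !inE yA cA // !andbT; split; last 1 first.
- by apply: contra tb; apply: subsetP.
- by apply: contra yb; apply: subsetP.
- by apply: contraNneq neq => ->.
Qed.

(** * Extending and interleaving greedy runs *)

Lemma greedy_stage_rcons A S p :
  greedy_stage A S -> greedy_choice S p -> greedy_stage A (S :\ p).
Proof.
move=> sS [pS p0 pmax]; apply: greedy_remove => //; exact: num_lines_noncapset p0.
Qed.

(** The inductive definition grows a run at its end; merging two runs needs access to the first
    removal. *)
Lemma greedy_stage_cons A C p :
  greedy_choice A p -> greedy_stage (A :\ p) C -> greedy_stage A C.
Proof.
move=> ch; elim=> [|S q _ IH nS qS q0 qmax]; first exact: greedy_stage_rcons (greedy_start A) ch.
exact: greedy_remove.
Qed.

Lemma greedy_stage_head A C : greedy_stage A C ->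
  A = C \/ exists2 p, greedy_choice A p & greedy_stage (A :\ p) C.
Proof.
elim=> [|S q _ IH nS qS q0 qmax]; first by left.
right; case: IH => [eA | [p ch sp]].
  by exists q; rewrite eA; [split | left].
by exists p => //; apply: greedy_remove.
Qed.

Lemma greedy_stage_sub A S : greedy_stage A S -> S \subset A.
Proof. by elim=> // S' q _ IH _ _ _ _; apply: subset_trans IH; apply: subD1set. Qed.

Lemma hyperplaneU_slice a b c A B : b != c -> A \subset hyperplane a b ->
  B \subset hyperplane a c -> (A :|: B) :&: hyperplane a b = A.
Proof.
move=> neq Ab Bc; apply/setP => x; rewrite !in_setI !in_setU.
have [xA | _] /= := boolP (x \in A); first by rewrite (subsetP Ab).
apply/negbTE/andP => -[/(subsetP Bc) xc xb].
by rewrite (hyperplane_inj xb xc) eqxx in neq.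
Qed.

Lemma hyperplaneU_avoid a b c d A B : b != d -> c != d -> A \subset hyperplane a b ->
  B \subset hyperplane a c -> (A :|: B) :&: hyperplane a d = set0.
Proof.
move=> bd cd Ab Bc; apply/setP => x; rewrite !in_setI in_setU in_set0.
apply/negbTE/andP => -[/orP[/(subsetP Ab) xb | /(subsetP Bc) xb] xd].
  by rewrite (hyperplane_inj xb xd) eqxx in bd.
by rewrite (hyperplane_inj xb xd) eqxx in cd.
Qed.

(** The union avoids the third hyperplane, so each of its lines lies in [A] or in [B] and line
    counts in the union are those of the parts. *)
Lemma greedy_choiceU a b c d A B p : b != c -> b != d -> c != d ->
  A \subset hyperplane a b -> B \subset hyperplane a c -> greedy_choice A p ->
  (forall q, q \in B -> (num_lines B q <= num_lines A p)%N) ->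
  greedy_choice (A :|: B) p.
Proof.
move=> bc bd cd Ab Bc [pA p0 pmax] pmaxB.
have S0 := hyperplaneU_avoid bd cd Ab Bc.
have nA q : q \in A -> num_lines (A :|: B) q = num_lines A q.
  move=> qA; rewrite -(num_lines_slice S0 _ (subsetP Ab _ qA)) ?inE ?qA //.
  by rewrite (hyperplaneU_slice bc Ab Bc).
have nB q : q \in B -> num_lines (A :|: B) q = num_lines B q.
  move=> qB; rewrite -(num_lines_slice S0 _ (subsetP Bc _ qB)) ?inE ?qB ?orbT //.
  by rewrite setUC (hyperplaneU_slice _ Bc Ab) // eq_sym.
split; rewrite ?nA // ?inE ?pA // => q; rewrite inE => /orP[] qS.
  by rewrite nA // pmax.
by rewrite nB // pmaxB.
Qed.

Lemma greedy_merge a b c d A B C D : b != c -> b != d -> c != d ->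
  A \subset hyperplane a b -> B \subset hyperplane a c ->
  greedy_capset A C -> greedy_capset B D -> greedy_stage (A :|: B) (C :|: D).
Proof.
have [m] := ubnP (#|A| + #|B|); elim: m => // m IH in b c A B C D *.
move=> le_m bc bd cd Ab Bc gA gB.
(* One removal from the first part; stated for arbitrary parts so that it also serves with the two
   parts exchanged. *)
have step b' c' A' B' C' D' p : (#|A'| + #|B'| < m.+1)%N ->
    b' != c' -> b' != d -> c' != d ->
    A' \subset hyperplane a b' -> B' \subset hyperplane a c' ->
    greedy_capset B' D' -> greedy_choice A' p -> greedy_stage (A' :\ p) C' -> capset C' ->
    (forall q, q \in B' -> (num_lines B' q <= num_lines A' p)%N) ->
    greedy_stage (A' :|: B') (C' :|: D').
  move=> le_m' bc' bd' cd' Ab' Bc' gB' ch sC cC pmax.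
  have [pA _ _] := ch.
  have pB : p \notin B'.
    apply: contra bc' => /(subsetP Bc') pc.
    by rewrite (hyperplane_inj (subsetP Ab' _ pA) pc).
  apply: greedy_stage_cons (greedy_choiceU bc' bd' cd' Ab' Bc' ch pmax) _.
  have -> : (A' :|: B') :\ p = A' :\ p :|: B'.
    by rewrite setDUl (setDidPl (_ : [disjoint B' & [set p]])) // disjoint_sym disjoints1.
  apply: IH bc' bd' cd' _ Bc' _ gB' => //.
    by move: le_m'; rewrite (cardsD1 p A') pA.
  exact: subset_trans (subD1set _ _) Ab'.
have [[sC cC] [sD cD]] := (gA, gB).
(* A part that is already finished is a capset, so its line counts are zero and the other part
   supplies the next point. *)
case: (greedy_stage_head sC) (greedy_stage_head sD) => [eA | [p chp sp]] [eB | [q chq sq]].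
- by rewrite eA eB; left.
- rewrite setUC [C :|: D]setUC; apply: (step c b _ _ _ _ q) => //.
  + by rewrite addnC.
  + by rewrite eq_sym.
  + by move=> r; rewrite eA capset_num_lines.
- apply: (step b c _ _ _ _ p) => //.
  by move=> r; rewrite eB capset_num_lines.
have [[_ _ pmax] [_ _ qmax]] := (chp, chq).
case: (leqP (num_lines B q) (num_lines A p)) => [le | /ltnW le].
  by apply: (step b c _ _ _ _ p) => // r /qmax /leq_trans; apply.
rewrite setUC [C :|: D]setUC; apply: (step c b _ _ _ _ q) => //.
- by rewrite addnC.
- by rewrite eq_sym.
- by move=> r /pmax /leq_trans; apply.
Qed.

(* While only part of H is removed, a chord of the removed set has its third
   point in H, so some point of H always attains the maximum. *)
Lemma greedy_remove_hyperplane a b A : third_closed A -> transverse a A ->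
  greedy_stage A (A :\: hyperplane a b).
Proof.
move=> cA tA; pose H := A :&: hyperplane a b.
suff [R [RH cardR]] : exists R, [/\ R \subset H, #|R| = #|H| & greedy_stage A (A :\: R)].
  suff -> : A :\: hyperplane a b = A :\: R by [].
  have -> : R = H by apply/eqP; rewrite eqEcard RH cardR leqnn.
  by rewrite /H setDIr setDv set0U.
(* Induction on the number of points of [H] removed so far, bounded by the size of [H]. *)
elim: {-2}#|H| (leqnn #|H|) => [|k IH] lek.
  by exists set0; rewrite sub0set cards0 setD0; split => //; left.
have [R [RH cardR sR]] := IH (ltnW lek).
have /card_gt0P[q0 q0H] : (0 < #|H :\: R|)%N.
  by rewrite cardsD (setIidPr RH) cardR subn_gt0.
case: (arg_maxnP (num_lines (A :\: R)) q0H) => p pHR pmax.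
have RA : R \subset A by apply: subset_trans RH (subsetIl _ _).
have Rb : R \subset hyperplane a b by apply: subset_trans RH (subsetIr _ _).
have : p \in H :\: R by []; rewrite !in_setD in_setI => /and3P[pR pA pb].
have pS : p \in A :\: R by rewrite in_setD pR.
exists (p |: R); split.
- by rewrite subUset sub1set in_setI pA pb.
- by rewrite cardsU1 pR cardR.
rewrite setUC -setDDl; apply: greedy_stage_rcons => //; split=> //.
  exact: num_lines_transverse Rb pA pb pR.
move=> q; rewrite in_setD => /andP[qR qA].
have [qb | qb] := boolP (q \in hyperplane a b).
  have qHR : q \in H :\: R by rewrite in_setD qR in_setI qA.
    exact: pmax.
rewrite (num_lines_leE cA) ?subsetDl //; last by rewrite in_setD qR.
rewrite setDDr setDv set0U (setIidPr RA).
case: (posnP (chords R q)) => [-> // | /chords_gt0P[y yR tR]].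
case/negP: qb; rewrite -(thirdK q y) (thirdC q).
by apply: hyperplane_closed; apply: (subsetP Rb).
Qed.

(** * Location of the removed set during a greedy run *)

Lemma exists_transverse A x y : x \in A -> y \in A -> x != y -> exists a, transverse a A.
Proof.
move=> xA yA neq.
have [i nei] : exists i, (x - y) 0 i != 0 by apply: rV_neq0; rewrite subr_eq0.
exists (delta_mx 0 i), x, y; split=> //.
by rewrite -subr_eq0 -dotB dotC dot_delta.
Qed.

(* A combination of the functional of H and one separating q from R that is
   constant on R and p. *)
Lemma hyperplane_extend a b A R q p : third_closed R -> R \subset hyperplane a b ->
  transverse a A -> R \subset A -> q \in A -> q \in hyperplane a b -> q \notin R ->
  exists a' b', transverse a' A /\ p |: R \subset hyperplane a' b'.
Proof.
move=> cR Rb tA RA qA qb qR.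
have [-> | nzR] := eqVneq R set0.
  by exists a, (- dot a p); rewrite setU0 sub1set in_hyperplaneN.
have [f [r rR [fR fq]]] := closed_separation cR nzR qR.
have [pb | pb] := boolP (p \in hyperplane a b).
  by exists a, b; rewrite subUset sub1set pb.
have aE x : x \in hyperplane a b -> dot a x = - b by rewrite in_hyperplane => /eqP.
have neq : dot a p - - b != 0 by rewrite subr_eq0 -in_hyperplane.
(* The coefficients make [g] agree at [p] and [r]. Since [a] agrees at [q] and [r] and the
   coefficient of [f] is nonzero, [g] still separates [q] from [r]. *)
pose g := (dot f p - dot f r) *: a - (dot a p - - b) *: f.
exists g, (- dot g r); split.
  exists q, r; split=> //; first exact: (subsetP RA).
  rewrite !dotZBl (aE _ qb) (aE _ (subsetP Rb _ rR)).
  by rewrite (inj_eq (addrI _)) eqr_opp (inj_eq (mulfI neq)).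
rewrite subUset sub1set !in_hyperplane opprK; apply/andP; split.
  by apply/eqP; rewrite !dotZBl (aE _ (subsetP Rb _ rR)); ring.
apply/subsetP => x xR; rewrite in_hyperplane opprK !dotZBl (fR x xR).
by rewrite (aE _ (subsetP Rb _ xR)) (aE _ (subsetP Rb _ rR)).
Qed.

(** The second phase of a run: one hyperplane is emptied, and each parallel slice is at a stage of
    its own greedy construction. *)
Definition split_stage A S a b : Prop :=
  S :&: hyperplane a b = set0 /\
  forall c, c != b -> greedy_stage (A :&: hyperplane a c) (S :&: hyperplane a c).

Lemma split_stage_choice A S a b p : split_stage A S a b -> greedy_choice S p ->
  split_stage A (S :\ p) a b.
Proof.
case=> S0 sS [pS p0 pmax]; split.
  by apply/eqP; rewrite -subset0 -S0 setSI // subD1set.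
move=> c cb; have [pc | pc] := boolP (p \in hyperplane a c); last first.
  rewrite setIDAC (setDidPl (_ : [disjoint S :&: hyperplane a c & [set p]])).
    exact: sS.
  by rewrite disjoint_sym disjoints1 in_setI negb_and pc orbT.
rewrite setIDAC; apply: greedy_stage_rcons (sS c cb) _; split.
- by rewrite in_setI pS.
- by rewrite (num_lines_slice S0).
- by move=> q /setIP[qS qc]; rewrite !(num_lines_slice S0) // pmax.
Qed.

Lemma split_stage_start A S a b : S \subset A -> A :\: S \subset hyperplane a b ->
  S :&: hyperplane a b = set0 -> split_stage A S a b.
Proof.
move=> SA Rb S0; split=> // c cb.
suff -> : S :&: hyperplane a c = A :&: hyperplane a c by left.
apply/setP => x; rewrite !in_setI; have [xc | _] := boolP (x \in hyperplane a c); rewrite ?andbF ?andbT //.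
apply/idP/idP => [/(subsetP SA) // | xA]; apply: contraNT cb => xS.
by rewrite (hyperplane_inj xc (subsetP Rb x _)) // in_setD xS.
Qed.

(** The invariant of a run. The hyperplane is not fixed in advance: it may be replaced as long as
    the removed set has not filled it. *)
Lemma greedy_stage_structure A S x y : third_closed A ->
  x \in A -> y \in A -> x != y -> greedy_stage A S ->
  exists a b, transverse a A /\ (A :\: S \subset hyperplane a b \/ split_stage A S a b).
Proof.
move=> cA xA yA neq; elim=> [|{}S p sS [a [b [tA IH]]] nS pS p0 pmax].
  have [a tA] := exists_transverse xA yA neq.
  by exists a, 0; split=> //; left; rewrite setDv sub0set.
have ch : greedy_choice S p by split.
have SA := greedy_stage_sub sS.
case: IH => [Rb | sp]; last by exists a, b; split=> //; right; apply: split_stage_choice.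
have [S0 | /set0Pn[q /setIP[qS qb]]] := eqVneq (S :&: hyperplane a b) set0.
  exists a, b; split=> //; right; apply: split_stage_choice => //.
  exact: split_stage_start.
have pA := subsetP SA _ pS.
have -> : A :\: (S :\ p) = p |: (A :\: S).
  by rewrite setDDr (setIidPr _) ?sub1set // setUC.
have chordP z : (0 < chords (A :\: S) z)%N -> z \in hyperplane a b.
  case/chords_gt0P => w wR tR; rewrite -(thirdK z w) (thirdC z).
  by apply: hyperplane_closed; apply: (subsetP Rb).
(* A chord with third point [p] forces [p] into the current hyperplane, which can then be kept. *)
case: (posnP (chords (A :\: S) p)) => [chp | /chordP pb]; last first.
  by exists a, b; split=> //; left; rewrite subUset sub1set pb.
(* If [p] has no chord, then by maximality no remaining point has one, so the removed set is closed.
   As it misses [q] in the hyperplane, there is room to tilt the hyperplane so that it also contains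
   [p]. *)
have cR : third_closed (A :\: S).
  move=> u v uR vR; rewrite in_setD cA ?(subsetP (subsetDl A S)) // andbT.
  apply/negP => tS; have := pmax _ tS; rewrite (num_lines_leE cA) // chp leqn0.
  rewrite eqn0Ngt => /negP; apply; apply/chords_gt0P.
  by exists u => //; rewrite thirdC (thirdC u) thirdK.
have qR : q \notin A :\: S by rewrite in_setD qS.
have [a' [b' [tA' sub]]] := hyperplane_extend p cR Rb tA (subsetDl A S) (subsetP SA _ qS) qb qR.
by exists a', b'; split=> //; left.
Qed.

Lemma greedy_capset_split A C x y : third_closed A ->
  x \in A -> y \in A -> x != y -> greedy_capset A C ->
  exists a b, [/\ transverse a A, C :&: hyperplane a b = set0 &
    forall c, c != b -> greedy_capset (A :&: hyperplane a c) (C :&: hyperplane a c)].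
Proof.
move=> cA xA yA neq [sC cC].
have CA := greedy_stage_sub sC.
have capI c a : capset (C :&: hyperplane a c).
  apply/forallP => L; apply/implyP => lL; have := forallP cC L; rewrite lL /=.
  by apply: contra => /subset_trans -> //; apply: subsetIl.
have [a [b [tA [Rb | [C0 sp]]]]] := greedy_stage_structure cA xA yA neq sC; last first.
  by exists a, b; split=> // c cb; split; [apply: sp | apply: capI].
have [C0 | /set0Pn[q /setIP[qC qb]]] := eqVneq (C :&: hyperplane a b) set0.
  exists a, b; split=> // c cb; split; last exact: capI.
  by case: (split_stage_start CA Rb C0) => _; apply.
(* A surviving point [q] of the hyperplane would still lie on a line inside [C], which is a
   capset. *)
have qR : q \notin A :\: C by rewrite in_setD qC.
have := num_lines_transverse cA tA Rb (subsetP CA _ qC) qb qR.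
by rewrite setDDr setDv set0U (setIidPr CA) capset_num_lines.
Qed.

Lemma greedy_capset_join A C a b : third_closed A -> transverse a A -> C \subset A ->
  C :&: hyperplane a b = set0 ->
  (forall c, c != b -> greedy_capset (A :&: hyperplane a c) (C :&: hyperplane a c)) ->
  greedy_capset A C.
Proof.
move=> cA tA CA C0 gC; split; last first.
  apply/capsetP => x xC.
  rewrite -(num_lines_slice C0 xC (in_hyperplaneN a x)) capset_num_lines //.
  have /gC[] // : - dot a x != b.
  by rewrite -(inj_eq oppr_inj) opprK; apply: avoid_hyperplane xC.
have D0 : (A :\: hyperplane a b) :&: hyperplane a b = set0.
  by rewrite setIDAC -setIDA setDv setI0.
have D c : c != b -> (A :\: hyperplane a b) :&: hyperplane a c = A :&: hyperplane a c.
  move=> cb; apply/setP => x; rewrite !in_setI in_setD.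
  have [xc | _] := boolP (x \in hyperplane a c); rewrite ?andbF ?andbT //.
  by rewrite (contra _ cb) // => xb; rewrite (hyperplane_inj xc xb).
have sD := greedy_remove_hyperplane b cA tA.
(* Once the hyperplane is emptied, the runs in its two parallels are interleaved. *)
have sDC : greedy_stage (A :\: hyperplane a b) C.
  rewrite (hyperplane_cover D0) [X in greedy_stage _ X](hyperplane_cover C0) !D ?F3_addr_neq //.
  apply: (@greedy_merge a (b + 1) (b - 1) b); rewrite ?F3_addr_neq ?subsetIr //.
  - by rewrite (inj_eq (addrI _)).
  - by apply: gC; rewrite F3_addr_neq.
  - by apply: gC; rewrite F3_addr_neq.
(* The two runs are concatenated. *)
elim: sDC => // S p _ IH *; exact: greedy_remove.
Qed.

(** * Dimension, parallels and cardinality in affine subspaces *)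

Lemma affine_subspace_hyperplane d a b A : affine_subspace d.+1 A ->
  transverse a A -> affine_subspace d (A :&: hyperplane a b).
Proof.
move=> aA tA; have cA := affine_subspace_closed aA.
have [r rA rb] := transverse_meets b cA tA; have [x [y [xA yA neq]]] := tA.
case/existsP: aA rA xA yA => p /existsP[U /andP[/eqP rkU /eqP eA]].
rewrite eA !inE => rU xU yU.
have subU u v : (u - p <= U)%MS -> (v - p <= U)%MS -> (u - v <= U)%MS.
  by move=> uU vU; rewrite -(subrK p u) -addrA -[p - v]opprB addmx_sub // eqmx_opp.
(* The new direction is the kernel of the functional on [U]; its rank drops by one because
   transversality makes the functional nonzero on [U]. *)
apply/existsP; exists r; apply/existsP; exists (U :&: kermx a^T)%MS.
apply/andP; split; last first.
  apply/eqP/setP => z; rewrite in_setI in_hyperplane !inE sub_capmx; congr (_ && _).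
    apply/idP/idP => zU.
      exact: subU.
    by rewrite -(subrK r z) -addrA addmx_sub.
  move: rb; rewrite in_hyperplane => /eqP <-.
  rewrite -subr_eq0 -dotB dot_mulmx; apply/eqP/sub_kermxP => [e | ->]; last by rewrite mxE.
  by apply/rowP => i; rewrite ord1 e mxE.
have := mxrank_mul_ker U a^T; rewrite rkU.
suff -> : \rank (U *m a^T) = 1%N by rewrite add1n => -[->].
apply/eqP; rewrite eqn_leq rank_leq_col lt0n mxrank_eq0.
apply: contraNneq neq => Ua; rewrite -subr_eq0 -dotB dot_mulmx.
have /submxP[D ->] := subU _ _ xU yU.
by rewrite -mulmxA Ua mulmx0 mxE.
Qed.

Lemma affine_subspace_distinct d A : affine_subspace d.+1 A ->
  exists x y, [/\ x \in A, y \in A & x != y].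
Proof.
case/existsP => p /existsP[U /andP[/eqP rkU /eqP ->]].
have Unz : U != 0 by rewrite -mxrank_eq0 rkU.
exists p, (p + nz_row U); rewrite !inE subrr sub0mx [p + _]addrC addrK nz_row_sub.
by split; rewrite // -subr_eq0 opprD addrCA subrr addr0 oppr_eq0 nz_row_eq0.
Qed.

Lemma greedy_capset_affine_split d A C : affine_subspace d.+1 A -> greedy_capset A C ->
  exists a b, [/\ transverse a A, C :&: hyperplane a b = set0 &
    forall c, c != b -> greedy_capset (A :&: hyperplane a c) (C :&: hyperplane a c)].
Proof.
move=> aA; have [x [y [xA yA neq]]] := affine_subspace_distinct aA.
exact: greedy_capset_split (affine_subspace_closed aA) xA yA neq.
Qed.

(** Translation by [v] changes the constant by [- dot a v], so a translate inside [A] is another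
    level set of the same functional. *)
Lemma parallel_hyperplane A a b H : third_closed A -> transverse a A ->
  parallel_in A (A :&: hyperplane a b) H ->
  exists2 c, c != b & H = A :&: hyperplane a c.
Proof.
move=> cA tA [HA neqH [v eH]]; have [r rA rb] := transverse_meets b cA tA.
have vrA : v + r \in A by rewrite (subsetP HA) // eH imset_f // inE rA.
have shift z : (v + z \in hyperplane a (b - dot a v)) = (z \in hyperplane a b).
  by rewrite !in_hyperplane dotD opprB (inj_eq (addrI _)).
have eHc : H = A :&: hyperplane a (b - dot a v).
  apply/eqP; rewrite eqEsubset subsetI HA /=; apply/andP; split; apply/subsetP => y.
    by rewrite eH => /imsetP[z /setIP[_ zb] ->]; rewrite shift.
  case/setIP => yA yc; rewrite eH; apply/imsetP; exists (y - v); last by rewrite addrC subrK.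
  rewrite in_setI -shift [v + _]addrC subrK yc andbT.
  (* Writing [y - v] by third points of [y], [r] and [v + r], all in [A], keeps it in [A]. *)
  have -> : y - v = third (third y r) (v + r).
    by rewrite /third opprD opprK opprD addrACA subrr addr0.
  by rewrite cA // cA.
exists (b - dot a v) => //; apply: contraNneq neqH => e.
by rewrite eHc e.
Qed.

Lemma greedy_capset_recursively_split d A C :
  affine_subspace d A -> greedy_capset A C -> recursively_split d A C.
Proof.
elim: d A C => [|d IH] A C aA gC //=; split=> //.
have [a [b [tA C0 gCc]]] := greedy_capset_affine_split aA gC.
have CA := greedy_stage_sub gC.1.
exists (A :&: hyperplane a b); split.
- split; first exact: subsetIl.
  by exists d; split=> //; apply: affine_subspace_hyperplane.
- by rewrite setIA (setIidPl CA).
move=> H /(parallel_hyperplane (affine_subspace_closed aA) tA)[c cb ->].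
rewrite setIA (setIidPl CA).
by apply: IH; [apply: affine_subspace_hyperplane | apply: gCc].
Qed.

Lemma greedy_stage_point p S : greedy_stage [set p] S -> S = [set p].
Proof.
elim=> // S' q _ eS nS; case/negP: nS; rewrite eS.
apply/capsetP => x _; apply/eqP; rewrite eqn0Ngt; apply/card_gt0P => -[L].
by rewrite inE => /and3P[/card_line cL _ /subset_leq_card]; rewrite cL cards1.
Qed.

Lemma card_greedy_capset d A C : affine_subspace d A -> greedy_capset A C ->
  #|C| = (2 ^ d)%N.
Proof.
elim: d A C => [|d IH] A C aA gC.
  have [p eA] : exists p, A = [set p].
    case/existsP: aA => p /existsP[U /andP[/eqP rkU /eqP ->]]; exists p.
    have /eqP -> : U == 0 by rewrite -mxrank_eq0 rkU.
    by apply/setP => x; rewrite !inE submx0 subr_eq0.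
  by move: gC.1; rewrite eA => /greedy_stage_point ->; rewrite cards1.
have [a [b [tA C0 gCc]]] := greedy_capset_affine_split aA gC.
have card (k : 'F_3) : k != 0 -> #|C :&: hyperplane a (b + k)| = (2 ^ d)%N.
  by move=> k0; apply: IH (gCc _ (F3_addr_neq b k0)); apply: affine_subspace_hyperplane.
rewrite (hyperplane_cover C0) cardsU !card // setIACA.
suff -> : hyperplane a (b + 1) :&: hyperplane a (b - 1) = set0.
  by rewrite setI0 cards0 subn0 addnn -mul2n expnS.
apply/setP => x; rewrite in_setI in_set0; apply/negbTE/andP => -[xb xc].
by have /addrI/eqP := hyperplane_inj xb xc.
Qed.

End Greedy.

(** * The whole space *)

Lemma affine_subspaceT n : affine_subspace n [set: 'rV['F_3]_n].
Proof.
apply/existsP; exists 0; apply/existsP; exists 1%:M; rewrite mxrank1 eqxx /=.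
by apply/eqP/setP => x; rewrite !inE submx1.
Qed.

Lemma transverseT n (a : 'rV['F_3]_n) : transverse a [set: 'rV['F_3]_n] <-> a != 0.
Proof.
split=> [[x [y [_ _]]] | /rV_neq0[i nzi]].
  by apply: contraNneq => ->; rewrite !dot_mulmx trmx0 !mulmx0.
by exists (delta_mx 0 i), 0; rewrite !in_setT dot_delta dot_mulmx mul0mx mxE.
Qed.

Theorem theorem3p2 (n : nat) (hn : (1 <= n)%N) (C : {set 'rV['F_3]_n}) :
  [/\ greedy_capset [set: 'rV['F_3]_n] C <->
        (exists (a : 'rV['F_3]_n) (b : 'F_3),
          [/\ a != 0,
              C :&: hyperplane a b = set0 &
              forall c : 'F_3, c != b ->
                greedy_capset (hyperplane a c) (C :&: hyperplane a c)]),
      greedy_capset [set: 'rV['F_3]_n] C ->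
        exists (a : 'rV['F_3]_n) (b : 'F_3),
          [/\ a != 0,
              C :&: hyperplane a b = set0 &
              forall c : 'F_3, c != b ->
                recursively_split n.-1 (hyperplane a c) (C :&: hyperplane a c)]
    & greedy_capset [set: 'rV['F_3]_n] C -> #|C| = (2 ^ n)%N].

Proof.
have cT := affine_subspace_closed (affine_subspaceT n).
have split_hyp : greedy_capset [set: 'rV['F_3]_n] C -> exists a b,
    [/\ a != 0, C :&: hyperplane a b = set0 & forall c : 'F_3, c != b ->
         greedy_capset (hyperplane a c) (C :&: hyperplane a c)].
  (* Positive dimension provides the two distinct points that the splitting requires. *)
  case: n hn C cT => // m _ C _ gC.
  have [a [b [/transverseT nz C0 gCc]]] := greedy_capset_affine_split (affine_subspaceT _) gC.
  by exists a, b; split=> // c /gCc; rewrite setTI.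
split; last exact/card_greedy_capset/affine_subspaceT.
  split=> // -[a [b [/transverseT tA C0 gCc]]].
  by apply: greedy_capset_join cT tA (subsetT C) C0 _ => c /gCc; rewrite setTI.
move=> /split_hyp[a [b [nz C0 gCc]]]; exists a, b; split=> // c cb.
apply: greedy_capset_recursively_split (gCc c cb).
rewrite -[hyperplane a c]setTI; apply: affine_subspace_hyperplane; last exact/transverseT.
by rewrite prednK //; apply: affine_subspaceT.
Qed.
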